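(* Let $p$ be an odd prime and let $G$ be a graph on $p$ vertices. Then $p$ does not divide $|[G]|$ if and only if $G=\overline{K}_p$ or $G$ is isomorphic to one of the graphs $C(s_1,s_2,\ldots,s_l)$, where $l\geq 1$ and $s_1,\ldots,s_l$ are distinct elements of $\{1,2,\ldots,(p-1)/2\}$.
   Context: Graphs are finite and simple. For a graph $G$ on $n$ vertices (with a fixed vertex set of size $n$), $[G]$ denotes its isomorphism class, i.e. the set of all graphs on that same vertex set isomorphic to $G$; thus $|[G]|=n!/|\mathrm{Aut}(G)|$. $\overline{K}_p$ is the graph on $p$ vertices with no edges. For $s\in\{1,2,\ldots,(p-1)/2\}$, $C(s)$ is the cycle graph of length $p$ with vertex set the finite field $\mathbb{F}_p=\{0,1,\ldots,p-1\}$ and edges $\{0,s\},\{s,2s\},\{2s,3s\},\ldots,\{(p-1)s,0\}$ (arithmetic in $\mathbb{F}_p$). For distinct $s_1,\ldots,s_l\in\{1,\ldots,(p-1)/2\}$, $C(s_1,\ldots,s_l)$ is the graph with vertex set $\mathbb{F}_p$ whose edge set is the union of the edge sets of $C(s_1),\ldots,C(s_l)$. *)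

(* Defs.v *)
From mathcomp Require Import all_boot all_order all_algebra.

Set Implicit Arguments.
Unset Strict Implicit.
Unset Printing Implicit Defensive.

(* A graph with vertex set the finite type [T] is given by its set of edges;
   an edge is an unordered pair of vertices, encoded as a [{set T}].  The
   predicate [simple_graph] says that every edge has two distinct endpoints. *)
Definition simple_graph (T : finType) (G : {set {set T}}) : bool :=
  [forall e in G, #|e| == 2].

Definition empty_graph (T : finType) : {set {set T}} := set0.

Definition graph_isom (T U : finType) (G : {set {set T}}) (H : {set {set U}})
    (f : {ffun T -> U}) : bool :=
  [&& injectiveb f, [forall u, u \in codom f]
    & [forall x, forall y,
        ([set x; y] \in G) == ([set f x; f y] \in H)]].

Definition isomorphic (T U : finType) (G : {set {set T}}) (H : {set {set U}}) :
    bool :=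
  [exists f : {ffun T -> U}, graph_isom G H f].

Definition iso_class (T : finType) (G : {set {set T}}) : {set {set {set T}}} :=
  [set H : {set {set T}} | simple_graph H & isomorphic G H].

(* For [k = p - 1] the second endpoint is [p * s = 0] in ['F_p]. *)
Definition cycle_graph (p s : nat) : {set {set 'F_p}} :=
  [set [set (k * s)%N%:R%R; (k.+1 * s)%N%:R%R] | k : 'I_p].

Definition circulant_graph (p : nat) (ss : seq nat) : {set {set 'F_p}} :=
  \bigcup_(s <- ss) cycle_graph p s.

Lemma circulant_graph_simple (p : nat) (ss : seq nat) :
  prime p -> all (fun s => 1 <= s <= (p - 1) %/ 2) ss ->
  simple_graph (circulant_graph p ss).
Proof.
move=> p_pr /allP ssP; apply/forall_inP => e; rewrite /circulant_graph.
elim: ss ssP => [|s ss IHss] ssP; first by rewrite big_nil inE.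
rewrite big_cons inE => /orP[|]; last first.
  by apply: IHss => t t_ss; apply: ssP; rewrite inE t_ss orbT.
case/imsetP=> k _ ->; rewrite cards2 eqSS eqb1 mulSn GRing.natrD.
have /andP[s_gt0 s_le] := ssP s (mem_head _ _).
rewrite -[X in X != _]GRing.add0r (inj_eq (GRing.addIr _)) eq_sym.
have p_char : p \in [pchar 'F_p]%R by apply: pchar_Fp.
rewrite -(GRing.dvdn_pcharf p_char) gtnNdvd //.
apply: leq_ltn_trans s_le _; apply: leq_ltn_trans (leq_div _ _) _.
by rewrite subn1 ltn_predL prime_gt0.
Qed.

(* Main.v *)
(* The class of [G] is its orbit under the symmetric group of order [p!], in
    which [p] occurs exactly once; so [p] does not divide the size of the class
    iff [p] divides that of the stabilizer of [G], i.e., by Cauchy, iff some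
    permutation [c] of order [p] preserves [G].  As [p] is the number of
    vertices, [c] is a single [p]-cycle, so after relabelling it is the
    translation by 1 of ['F_p], and the graphs preserved by all translations
    are the unions of the orbits of the edges [{0, s}], that is of the [C(s)]. *)

Require Import Defs.
From mathcomp Require Import all_boot all_order all_algebra.
From mathcomp Require Import all_fingroup all_solvable zify.

Set Implicit Arguments.
Unset Strict Implicit.
Unset Printing Implicit Defensive.

(** * Images of graphs under vertex maps *)

Definition map_edges (T U : finType) (f : T -> U) (G : {set {set T}}) :
  {set {set U}} := [set f @: e | e : {set T} in G].

Lemma eq_map_edges (T U : finType) (f g : T -> U) (G : {set {set T}}) :
  f =1 g -> map_edges f G = map_edges g G.
Proof. by move=> fg; apply: eq_imset => e; apply: eq_imset. Qed.

Lemma map_edges_id (T : finType) (G : {set {set T}}) : map_edges id G = G.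
Proof.
by rewrite -[RHS]imset_id; apply: eq_imset => e; rewrite imset_id.
Qed.

Lemma map_edges_comp (T U V : finType) (g : U -> V) (f : T -> U)
    (G : {set {set T}}) :
  map_edges g (map_edges f G) = map_edges (g \o f) G.
Proof.
by rewrite /map_edges -imset_comp; apply: eq_imset => e; rewrite /= -imset_comp.
Qed.

Lemma imset_set2 (T U : finType) (f : T -> U) (x y : T) :
  f @: [set x; y] = [set f x; f y].
Proof. by rewrite imsetU1 imset_set1. Qed.

Lemma simple_graphP (T : finType) (G : {set {set T}}) (e : {set T}) :
  simple_graph G -> e \in G -> exists x y : T, x != y /\ e = [set x; y].
Proof. by move=> /forall_inP sG /sG /cards2P. Qed.

Lemma simple_map_edges (T U : finType) (f : T -> U) (G : {set {set T}}) :
  injective f -> simple_graph G -> simple_graph (map_edges f G).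
Proof.
move=> inj_f /forall_inP sG; apply/forall_inP => _ /imsetP[e eG ->].
by rewrite card_imset // sG.
Qed.

(** Every edge of a simple graph is a pair, so preserving and reflecting membership of pairs amounts
    to carrying one edge set onto the other. This form is what group actions can use. *)
Lemma isomorphicP (T U : finType) (G : {set {set T}}) (H : {set {set U}}) :
  simple_graph G -> simple_graph H ->
  reflect (exists2 f : T -> U, bijective f & H = map_edges f G)
          (isomorphic G H).
Proof.
move=> sG sH; apply: (iffP existsP) => [[f /and3P[/injectiveP inj_f]]|].
  move=> /forallP surj_f /forallP isoP; exists f.
    apply: inj_card_bij => //; rewrite -(card_codom inj_f).
    by apply/subset_leq_card/subsetP => u _; apply: surj_f.
  have isoE x y : ([set x; y] \in G) = ([set f x; f y] \in H).
    by have /forallP/(_ y)/eqP := isoP x.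
  apply/setP => e; apply/idP/imsetP => [eH|[d dG ->]].
    have [a [b [_ def_e]]] := simple_graphP sH eH.
    have /codomP[x def_a] := surj_f a; have /codomP[y def_b] := surj_f b.
    exists [set x; y]; last by rewrite imset_set2 -def_a -def_b.
    by rewrite isoE -def_a -def_b -def_e.
  have [x [y [_ def_d]]] := simple_graphP sG dG.
  by rewrite def_d imset_set2 -isoE -def_d.
case=> f bij_f ->; exists [ffun x => f x]; have inj_f := bij_inj bij_f.
apply/and3P; split.
- by apply/injectiveP => x y; rewrite !ffunE => /inj_f.
- apply/forallP => u; apply/codomP; case: bij_f => g _ gK.
  by exists (g u); rewrite ffunE gK.
apply/forallP => x; apply/forallP => y; rewrite !ffunE; apply/eqP.
by rewrite -imset_set2 mem_imset //; apply: imset_inj.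
Qed.

(** * Isomorphism classes as orbits *)

Local Notation graph_action := (('P^*)^*)%act.

(** The first [^*] lifts the action on vertices to edges, the second to sets of edges. *)
Lemma graph_actE (T : finType) (G : {set {set T}}) (c : {perm T}) :
  graph_action G c = map_edges c G.
Proof. by []. Qed.

Lemma iso_class_orbit (T : finType) (G : {set {set T}}) :
  simple_graph G -> iso_class G = orbit graph_action [set: {perm T}] G.
Proof.
move=> sG; apply/setP => H; rewrite inE.
apply/andP/orbitP => [[sH /(isomorphicP sG sH)[f /bij_inj inj_f ->]]|].
  exists (perm inj_f); first by rewrite inE.
  by rewrite graph_actE; apply: eq_map_edges; apply: permE.
case=> c _ <-; rewrite graph_actE.
have sH: simple_graph (map_edges c G) by apply: simple_map_edges perm_inj _.
split=> //; apply/(isomorphicP sG sH); exists c => //.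
by exists (c^-1)%g; [apply: permK | apply: permKV].
Qed.

Lemma prime_ndvd_fact (p n : nat) : prime p -> n < p -> ~~ (p %| n`!).
Proof.
move=> p_pr; elim: n => [|n IHn] n_lt.
  by rewrite fact0 dvdn1 gtn_eqF ?prime_gt1.
by rewrite factS Euclid_dvdM // gtnNdvd // IHn // ltnW.
Qed.

Lemma prime_ndvd_iso_class (p : nat) (T : finType) (G : {set {set T}}) :
  prime p -> #|T| = p -> simple_graph G ->
  ~~ (p %| #|iso_class G|) =
  [exists c : {perm T}, (#[c]%g == p) && (map_edges c G == G)].
Proof.
move=> p_pr card_T sG; rewrite iso_class_orbit //.
have card_orb := card_orbit_stab graph_action [set: {perm T}]%G G.
have card_S : #|[set: {perm T}]| = p`! by rewrite -card_T -card_Sym.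
rewrite card_S in card_orb.
apply/idP/existsP => [ndvd | [c /andP[/eqP c_p /eqP cG]]].
  have : p %| p`! by rewrite dvdn_fact // prime_gt0 /=.
  rewrite -card_orb Euclid_dvdM // (negPf ndvd) /=.
  case/(Cauchy p_pr) => c; rewrite inE => /andP[_ /astab1P cG] c_p.
  by exists c; rewrite c_p eqxx -graph_actE cG eqxx.
apply/negP => dvd_orb.
have dvd_stab : p %| #|'C_[set: {perm T}][G | graph_action]%g|.
  by rewrite -c_p order_dvdG //; apply/setIP;
    split; [apply: in_setT | apply/astab1P].
(* If [p] divided both orbit and stabilizer, [p ^ 2] would divide [p * (p - 1)!], hence [p] would
   divide [(p - 1)!]. *)
have : p ^ 2 %| p`! by rewrite -card_orb expnS expn1 dvdn_mul.
rewrite -[p in _ %| p`!]prednK ?prime_gt0 // factS prednK ?prime_gt0 //.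
rewrite expnS expn1 dvdn_pmul2l ?prime_gt0 //.
by rewrite (negPf (prime_ndvd_fact p_pr _)) // ltn_predL prime_gt0.
Qed.

(** * Labelling the vertices by ['F_p] *)

Import GRing.Theory.
Local Open Scope ring_scope.

(** The cycle of a point [x] moved by [c] has length dividing [p] and different from 1, so it fills
    [T]; the label [i] goes to [c ^+ i] applied to [x]. *)
Lemma prime_cycle_coordinate (p : nat) (T : finType) (c : {perm T}) :
  prime p -> #|T| = p -> #[c]%g = p ->
  exists2 g : 'F_p -> T, bijective g & forall i, g (i + 1) = c (g i).
Proof.
move=> p_pr card_T c_p.
have [x cx] : exists x, c x != x.
  apply/existsP; apply: contraT; rewrite negb_exists => /forallP c1.
  have c_eq1 : c = 1%g.
    by apply/permP => x; rewrite perm1; apply/eqP; rewrite -[_ == _]negbK.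
  by move: p_pr; rewrite -c_p c_eq1 order1.
have card_x : #|porbit c x| = p.
  have : (#|porbit c x| %| p)%N by rewrite -c_p porbit.unlock dvdn_orbit.
  case/primeP: p_pr => _ /[apply] /orP[|/eqP //].
  case/cards1P => y Ey; have := mem_porbit c 1 x; have := porbit_id c x.
  by rewrite expg1 Ey !inE => /eqP <-; rewrite (negPf cx).
exists (fun i : 'F_p => (c ^+ i)%g x); last first.
  (* The exponent wraps around modulo [p], which is harmless because [c] has order [p]. *)
  move=> i; rewrite -[i in LHS]natr_Zp natr1.
  by rewrite /= val_Fp_nat // -[X in (_ %% X)%N]c_p expg_mod_order expgSr permM.
apply: (@inj_card_bij 'F_p T); last by rewrite card_Fp // card_T.
have lt_p (i : 'F_p) : (i < p)%N.
  by rewrite -[X in (_ < X)%N]card_Fp // card_ord.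
move=> i j; have := uniq_traject_porbit c x; rewrite card_x => uniq_x.
rewrite !permX -!(nth_traject c (lt_p _)) => /eqP.
by rewrite nth_uniq ?size_traject // => /eqP/val_inj.
Qed.

(** * Circulant graphs and translation invariance *)

Lemma in_bigcup_seq (I : Type) (U : finType) (r : seq I) (F : I -> {set U})
    (x : U) :
  (x \in \bigcup_(i <- r) F i) = has (fun i => x \in F i) r.
Proof.
by elim: r => [|i r IHr]; rewrite ?big_nil ?big_cons inE // IHr.
Qed.

(** Each [s] is nonzero modulo [p], so its multiples run through all of ['F_p] and an edge may start
    at any [x]: take the index [x / s]. *)
Lemma mem_circulant (p : nat) (ss : seq nat) (e : {set 'F_p}) :
  prime p -> all (fun s => 1 <= s <= (p - 1) %/ 2)%N ss ->
  reflect (exists2 s, s \in ss & exists x : 'F_p, e = [set x; x + s%:R])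
          (e \in circulant_graph p ss).
Proof.
move=> p_pr /allP ssP; rewrite /circulant_graph in_bigcup_seq.
apply: (iffP hasP) => [[s s_ss /imsetP[k _ ->]]|[s s_ss [x ->]]].
  by exists s => //; exists (k * s)%:R; rewrite mulSn addnC natrD.
have /andP[s_gt0 s_le] := ssP s s_ss.
have s_neq0 : s%:R != 0 :> 'F_p.
  rewrite -(dvdn_pcharf (pchar_Fp p_pr)) gtnNdvd //.
  apply: leq_ltn_trans s_le _; apply: leq_ltn_trans (leq_div _ _) _.
  by rewrite subn1 ltn_predL prime_gt0.
exists s => //; have lt_p : (nat_of_ord (x / s%:R)%R < p)%N.
  by rewrite -[X in (_ < X)%N]card_Fp // card_ord ltn_ord.
apply/imsetP; exists (Ordinal lt_p) => //=.
by rewrite mulSn natrD natrM (natr_Zp (x / s%:R)) divfK // addrC.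
Qed.

Lemma circulant_translate (p : nat) (ss : seq nat) :
  prime p -> all (fun s => 1 <= s <= (p - 1) %/ 2)%N ss ->
  map_edges (+%R 1) (circulant_graph p ss) = circulant_graph p ss.
Proof.
(* Translation is injective on edges, so one inclusion suffices. *)
move=> p_pr ssP; apply/eqP; rewrite eqEcard card_imset; last first.
  by apply: imset_inj; apply: addrI.
rewrite leqnn andbT; apply/subsetP => _ /imsetP[e eC ->].
have [s s_ss [x ->]] := mem_circulant e p_pr ssP eC.
apply/(mem_circulant _ p_pr ssP); exists s => //.
by exists (1 + x); rewrite imsetU1 imset_set1 addrA.
Qed.

Lemma translate_edge (p : nat) (H : {set {set 'F_p}}) (a x y : 'F_p) :
  map_edges (+%R 1) H = H -> [set x; y] \in H -> [set a + x; a + y] \in H.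
Proof.
move=> invH xyH; rewrite -(natr_Zp a); elim: {a}(nat_of_ord a) => [|n IHn].
  by rewrite !add0r.
rewrite mulrS -!addrA -invH -(imset_set2 (+%R 1)).
exact: imset_f.
Qed.

(** The neighbours of 0, with one representative kept from each pair [s], [- s]. *)
Definition connection_seq (p : nat) (H : {set {set 'F_p}}) : seq nat :=
  [seq s <- iota 1 ((p - 1) %/ 2) | [set 0; s%:R] \in H].

Lemma connection_seq_bounds (p : nat) (H : {set {set 'F_p}}) :
  all (fun s => 1 <= s <= (p - 1) %/ 2)%N (connection_seq H).
Proof.
by apply/allP => s; rewrite mem_filter mem_iota add1n ltnS => /andP[].
Qed.

Lemma circulant_connection_seq (p : nat) (H : {set {set 'F_p}}) :
  prime p -> odd p -> simple_graph H -> map_edges (+%R 1) H = H ->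
  circulant_graph p (connection_seq H) = H.
Proof.
move=> p_pr p_odd sH invH; have ssP := connection_seq_bounds H.
apply/setP => e; apply/(mem_circulant _ p_pr ssP)/idP => [[s]|eH].
  rewrite mem_filter => /andP[sHs _] [x ->].
  by have := translate_edge x invH sHs; rewrite addr0.
have [x [y [neq_xy def_e]]] := simple_graphP sH eH; rewrite {e}def_e in eH *.
have [d lt_dp def_y] : exists2 d, (d < p)%N & y = x + d%:R.
  exists (nat_of_ord (y - x)); last by rewrite (natr_Zp (y - x)) addrC subrK.
  by rewrite -[X in (_ < X)%N]card_Fp // card_ord ltn_ord.
(* Swapping the endpoints replaces [d] by [p - d]; as [p] is odd, one of the two is at most
   [(p - 1) / 2]. *)
wlog le_d : x y d lt_dp def_y neq_xy eH / (d <= (p - 1) %/ 2)%N => [IH|].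
  have [|d_gt] := leqP d ((p - 1) %/ 2); first exact: IH.
  rewrite setUC; apply: (IH y x (p - d)%N); rewrite 1?eq_sym 1?setUC //.
  - lia.
  - by rewrite def_y -addrA -natrD subnKC ?(ltnW lt_dp) // pchar_Fp_0 // addr0.
  - lia.
exists d; last by exists x; rewrite -def_y.
rewrite mem_filter mem_iota add1n ltnS le_d andbT lt0n.
(* Translating by [- x] moves the edge to one joining 0 and [d]. *)
have := translate_edge (- x) invH eH; rewrite def_y addNr addKr => -> /=.
by apply: contra neq_xy => /eqP d0; rewrite def_y d0 addr0.
Qed.

Local Close Scope ring_scope.

Theorem lemma3p2 (p : nat) (p_prime : prime p) (p_odd : odd p)
    (T : finType) (card_T : #|T| = p)
    (G : {set {set T}}) (G_simple : simple_graph G) :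
  ~~ (p %| #|iso_class G|) <->
  G = empty_graph T \/
  exists ss : seq nat,
    [/\ 1 <= size ss, uniq ss,
        all (fun s => 1 <= s <= (p - 1) %/ 2) ss
      & isomorphic G (circulant_graph p ss)].
Proof.
split.
  rewrite prime_ndvd_iso_class // => /existsP[c /andP[/eqP c_p /eqP cG]].
  have [g [h gK hK] g1] := prime_cycle_coordinate p_prime card_T c_p.
  (* The labelling [h] turns [c] into translation by 1, so the relabelled graph is translation
     invariant. *)
  have h1 x : h (c x) = (1 + h x)%R.
    by rewrite -{1}[x]hK -g1 gK GRing.addrC.
  have sH : simple_graph (map_edges h G).
    by apply: simple_map_edges => //; apply: can_inj hK.
  have invH : map_edges (+%R 1)%R (map_edges h G) = map_edges h G.
    rewrite -[in RHS]cG !map_edges_comp; apply: eq_map_edges => x /=.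
    by rewrite h1.
  have circH := circulant_connection_seq p_prime p_odd sH invH.
  (* An empty list of steps gives the edgeless graph, the separate first alternative. *)
  have [ss0 | ss_gt0] := posnP (size (connection_seq (map_edges h G))).
    left; rewrite (size0nil ss0) /circulant_graph big_nil in circH.
    rewrite -[G]map_edges_id -(eq_map_edges _ hK) -map_edges_comp -circH.
    exact: imset0.
  right; exists (connection_seq (map_edges h G)); split=> //.
  - by rewrite filter_uniq ?iota_uniq.
  - exact: connection_seq_bounds.
  - by rewrite circH; apply/isomorphicP => //; exists h => //; exists g.
case=> [->|[ss [_ _ ssP isoG]]].
  have s0 : simple_graph (empty_graph T) by apply/forall_inP => e; rewrite inE.
  (* All permutations fix the edgeless graph, so its class has one element. *)
  rewrite iso_class_orbit // (elimT orbit1P _).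
    by rewrite cards1 dvdn1 gtn_eqF ?prime_gt1.
  by apply/afixP => c _; apply: imset0.
have sC := circulant_graph_simple p_prime ssP.
have /(isomorphicP G_simple sC)[h [g hK gK] defC] := isoG.
rewrite prime_ndvd_iso_class //; apply/existsP.
(* The required permutation of order [p] is translation by 1 pulled back along the isomorphism
   [h]. *)
have inj_c : injective (fun x => g (1 + h x)%R).
  by move=> x y /(can_inj gK)/GRing.addrI/(can_inj hK).
have cX n x : ((perm inj_c) ^+ n)%g x = g (n%:R + h x)%R.
  elim: n => [|n IHn]; first by rewrite perm1 GRing.add0r hK.
  by rewrite expgSr permM IHn permE gK GRing.addrA -GRing.mulrS.
exists (perm inj_c); apply/andP; split; apply/eqP.
  apply: nt_prime_order => //.
    by apply/permP => x; rewrite cX pchar_Fp_0 // GRing.add0r hK perm1.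
  (* It is not the identity, since it sends [g 0] to [g 1]. *)
  apply/eqP => /permP/(_ (g 0%R)); rewrite permE perm1 gK => /(can_inj gK)/eqP.
  by rewrite GRing.addr0 GRing.oner_eq0.
rewrite (eq_map_edges _ (permE inj_c)).
rewrite -[RHS]map_edges_id -(eq_map_edges _ hK) -[RHS]map_edges_comp -defC.
by rewrite -(circulant_translate p_prime ssP) defC !map_edges_comp.
Qed.
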